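(* Let $\Gamma$ be a group with finite, symmetric generating set $S\subseteq\Gamma$, and let $P$ be the transition kernel of the simple random walk on the Cayley graph $\mathsf{Cay}(\Gamma;S)$, i.e. the walk moving from $g$ to $gs$ with $s\in S$ uniformly random. If $\Gamma$ does not have Kazhdan's property (T), then there exist a Hilbert space $\mathcal H$ and a nonconstant $\Gamma$-equivariant $P$-harmonic mapping $\Psi:\Gamma\to\mathcal H$.
   Context: Symmetric means $S=S^{-1}$. A map $\Psi:\Gamma\to\mathcal H$ is $P$-harmonic if $\Psi(g)=\frac1{|S|}\sum_{s\in S}\Psi(gs)$ for all $g\in\Gamma$. It is $\Gamma$-equivariant if there is an action $\pi$ of $\Gamma$ on $\mathcal H$ by affine isometries such that $\pi(g)\Psi(h)=\Psi(gh)$ for all $g,h\in\Gamma$ (i.e. with respect to the left-multiplication action of $\Gamma$ on itself). Cayley graphs are defined using multiplication by generators on the right. *)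

(* Defs.v *)
From HB Require Import structures.
From mathcomp Require Import all_boot all_order all_algebra.
From mathcomp Require Import finmap complex.
From mathcomp Require Import all_classical all_reals all_analysis.
Set Implicit Arguments.
Unset Strict Implicit.
Unset Printing Implicit Defensive.

Import Order.TTheory GRing.Theory Num.Theory.
Import numFieldNormedType.Exports.

Local Open Scope fset_scope.
Local Open Scope classical_set_scope.
Local Open Scope ring_scope.
Local Open Scope complex_scope.

(* Complex Hilbert spaces. The form is linear in its first argument, and norms *)
(* are nonnegative reals seen in R[i].                                         *)
Structure hilbertType (R : realType) := HilbertType {
  hilbert_sort :> completeNormedModType R[i];
  hdot : {dot hilbert_sort for Num.conj};
  hdot_norm : forall x : hilbert_sort, hdot x x = `|x| ^+ 2
}.

Arguments hdot {R h}.

(* [pi g] is onto for every [g] because [pi] is a homomorphism, so that the    *)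
(* isometries [pi g] are unitary operators. [G] is discrete: no continuity     *)
(* condition is needed.                                                        *)
Definition unitary_rep (R : realType) (G : groupType) (H : hilbertType R)
    (pi : G -> {linear H -> H}) : Prop :=
  [/\ forall x : H, pi 1%g x = x,
      forall (g h : G) (x : H), pi (g * h)%g x = pi g (pi h x)
    & forall (g : G) (x y : H), hdot (pi g x) (pi g y) = hdot x y].

Definition almost_invariant_vector (R : realType) (G : groupType)
    (H : hilbertType R) (pi : G -> {linear H -> H}) (Q : {fset G}) (e : R)
    (xi : H) : Prop :=
  xi != 0 /\ forall q : G, q \in Q -> `|pi q xi - xi| < e%:C * `|xi|.

Definition invariant_vector (R : realType) (G : groupType)
    (H : hilbertType R) (pi : G -> {linear H -> H}) (xi : H) : Prop :=
  forall g : G, pi g xi = xi.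

(* Compact subsets of the discrete group [G] are its finite subsets.           *)
Definition property_T (R : realType) (G : groupType) : Prop :=
  exists (Q : {fset G}) (e : R), 0 < e /\
    forall (H : hilbertType R) (pi : G -> {linear H -> H}),
      unitary_rep pi ->
      (exists xi : H, almost_invariant_vector pi Q e xi) ->
      exists xi : H, xi != 0 /\ invariant_vector pi xi.

Definition symmetric_set (G : groupType) (S : {fset G}) : Prop :=
  S = [fset (s^-1)%g | s in S].

Definition generating_set (G : groupType) (S : {fset G}) : Prop :=
  smallest (fun A : set G => group_closed [in A]) [set` S] = [set: G].

Definition srw_harmonic (R : realType) (G : groupType) (S : {fset G})
    (H : hilbertType R) (Psi : G -> H) : Prop :=
  forall g : G, Psi g = (#|` S|%:R)^-1 *: \sum_(s <- S) Psi (g * s)%g.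

Definition affine_isometry (R : realType) (H : hilbertType R) (A : H -> H)
    : Prop :=
  (exists (L : {linear H -> H}) (b : H), forall x : H, A x = L x + b) /\
  (forall x y : H, `|A x - A y| = `|x - y|).

Definition affine_isometric_action (R : realType) (G : groupType)
    (H : hilbertType R) (pi : G -> H -> H) : Prop :=
  [/\ forall g : G, affine_isometry (pi g),
      forall x : H, pi 1%g x = x
    & forall (g h : G) (x : H), pi (g * h)%g x = pi g (pi h x)].

Definition equivariant (R : realType) (G : groupType) (H : hilbertType R)
    (Psi : G -> H) : Prop :=
  exists pi : G -> H -> H, affine_isometric_action pi /\
    forall g h : G, pi g (Psi h) = Psi (g * h)%g.

(* Main.v *)
(* Since G is not (T), for every eps some unitary representation without       *)
(* invariant vectors carries a vector x with |D x|^2 <= eps <D x, x>, where D  *)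
(* = sum_s (1 - pi s): otherwise gradient descent for the energy <D x, x>      *)
(* would converge geometrically to an invariant vector, at a distance from x   *)
(* controlled by the energy, which contradicts the almost invariance of x.     *)
(* The kernels <pi g x - x, pi h x - x> / <D x, x> are bounded on the          *)
(* generators, hence pointwise bounded; as eps -> 0 they converge along an     *)
(* ultrafilter to a kernel K. Its sections are harmonic because the square of  *)
(* the defect at g is at most eps K(g, g), and they are not all zero because   *)
(* sum_s K(s, s) = 2 passes to the limit. The group acts by affine isometries  *)
(* on the reproducing kernel Hilbert space of K, moving the section K(-, h)    *)
(* to K(-, gh).                                                                *)
Require Import Defs.
From HB Require Import structures.
From mathcomp Require Import all_boot all_order all_algebra.
From mathcomp Require Import finmap complex ring lra.
From mathcomp Require Import all_classical all_reals all_analysis.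

Set Implicit Arguments.
Unset Strict Implicit.
Unset Printing Implicit Defensive.

Import Order.TTheory GRing.Theory Num.Theory.
Import numFieldNormedType.Exports.

Local Open Scope classical_set_scope.
Local Open Scope ring_scope.
Local Open Scope complex_scope.

(** * Inner products from the parallelogram law *)

(** The harmonic map is the feature map [rkhs_section] of a limit of kernels, so no limit of Hilbert
    spaces or representations is formed. For a unitary representation, the map sending [g] to
    [pi g x - x] is an orbit map of an affine isometric action, and [orbit_kernel] is its Gram
    kernel divided by the energy. Kernel values alone express what is needed: equivariance is
    [orbit_kernel_cocycle], nonconstancy is [orbit_kernel_trace], approximate harmonicity is
    [orbit_kernel_harmonic]. These relations survive pointwise limits, and [orbit_kernel_bound]
    supplies the compactness, whence [harmonic_kernel_exists]. The failure of (T) produces the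
    kernels in [near_harmonic_kernel_exists], by way of [spectral_gap].

    The Hilbert space of the limit kernel consists of functions whose squared norm is the convex
    conjugate of the Gramian. The parallelogram law passes to the conjugate ([qnorm_par]), and the
    Jordan-von Neumann theorem then yields the inner product. *)

Lemma additive_bounded_linear (R : realType) (phi : R -> R) (M : R) :
  {morph phi : x y / x + y} -> (forall t, `|t| <= 1 -> `|phi t| <= M) ->
  forall t, phi t = t * phi 1.
Proof.
move=> phiD phiM t.
have phi0 : phi 0 = 0 by have := phiD 0 0; rewrite addr0; lra.
have phiN x : phi (- x) = - phi x.
  by have := phiD x (- x); rewrite subrr phi0; lra.
(* [h] is additive and vanishes on the integers, so it is 1-periodic and hence bounded on the whole
   line; a bounded additive map is zero. *)
pose h x := phi x - x * phi 1.
have hD x y : h (x + y) = h x + h y by rewrite /h phiD; ring.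
have hn x n : h (x *+ n) = h x *+ n.
  elim: n => [|n IH]; first by rewrite !mulr0n /h phi0; ring.
  by rewrite !mulrS hD IH.
have hN x : h (- x) = - h x by rewrite /h phiN; ring.
have h1 : h 1 = 0 by rewrite /h; ring.
have hz (z : int) : h z%:~R = 0.
  case: z => n; first by rewrite -pmulrn hn h1 mul0rn.
  by rewrite NegzE rmorphN hN /= -pmulrn hn h1 mul0rn oppr0.
have hM x : `|h x| <= M + `|phi 1|.
  have -> : h x = h (x - (Num.floor x)%:~R) by rewrite hD hN hz subr0.
  set y := x - _.
  have y1 : `|y| <= 1.
    rewrite /y; have := floor_le x; have := floorD1_gt x.
    by rewrite rmorphD /= ler_norml; lra.
  apply: le_trans (ler_normB _ _) _; apply: lerD; first exact: phiM.
  by rewrite normrM; rewrite ler_piMl.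
have [//|ht] := eqVneq (h t) 0; first by rewrite /h; lra.
have htp : 0 < `|h t| by rewrite normr_gt0.
have [n hn'] : exists n : nat, M + `|phi 1| < `|h t| *+ n.
  exists (Num.bound ((M + `|phi 1|) / `|h t|)).
  rewrite -mulr_natl -ltr_pdivrMr //; apply: archi_boundP.
  by rewrite divr_ge0 // (le_trans _ (hM 0)).
have := hM (t *+ n); rewrite hn normrMn; lra.
Qed.

Section JordanVonNeumann.
Variables (R : realType) (V : lmodType R[i]) (p : V -> R).
Hypothesis p_ge0 : forall x, 0 <= p x.
Hypothesis p_par : forall x y, p (x + y) + p (x - y) = 2 * p x + 2 * p y.
Hypothesis pZ : forall (z : R[i]) x,
  p (z *: x) = (complex.Re z ^+ 2 + complex.Im z ^+ 2) * p x.

Definition polar x y := (p (x + y) - p (x - y)) / 4.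

Let pN x : p (- x) = p x.
Proof. by rewrite -scaleN1r pZ /=; ring. Qed.

Let pZr (a : R) x : p (a%:C *: x) = a ^+ 2 * p x.
Proof. by rewrite pZ /=; ring. Qed.

Lemma polarC x y : polar x y = polar y x.
Proof. by rewrite /polar (addrC x y) -(pN (x - y)) opprB. Qed.

(** Four instances of the parallelogram law; their remaining terms cancel in pairs because [p] is
    even. *)
Lemma polarDl x y z : polar (x + y) z = polar x z + polar y z.
Proof.
have h1 := p_par (x + z) y; have h2 := p_par (y + z) x.
have h3 := p_par (x - z) y; have h4 := p_par (y - z) x.
have e1 : p (x + z - y) = p (y - z - x).
  by rewrite -pN; congr p; rewrite !opprD !opprK addrC (addrC (- _)) addrA.
have e2 : p (y + z - x) = p (x - z - y).
  by rewrite -pN; congr p; rewrite !opprD !opprK addrC (addrC (- _)) addrA.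
have e3 : x + z + y = x + y + z by rewrite addrAC.
have e4 : y + z + x = x + y + z by rewrite addrAC (addrC y).
have e5 : x - z + y = x + y - z by rewrite addrAC.
have e6 : y - z + x = x + y - z by rewrite addrAC (addrC y).
rewrite e3 in h1; rewrite e4 in h2; rewrite e5 in h3; rewrite e6 in h4.
rewrite /polar; lra.
Qed.

Lemma polarZl a x y : polar (a%:C *: x) y = a * polar x y.
Proof.
have := @additive_bounded_linear R (fun a => polar (a%:C *: x) y)
  (p x + p y) _ _ a.
rewrite /= scale1r; apply.
  by move=> b c /=; rewrite rmorphD /= scalerDl polarDl.
move=> t t1; have h := p_par (t%:C *: x) y; rewrite pZr in h.
have t2 : t ^+ 2 * p x <= p x.
  apply: ler_piMl => //; rewrite -(real_normK (num_real t)).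
  by rewrite expr_le1.
have h1 := p_ge0 (t%:C *: x + y); have h2 := p_ge0 (t%:C *: x - y).
by rewrite /polar ler_norml; apply/andP; split; have := p_ge0 y; lra.
Qed.

Lemma polarxx x : polar x x = p x.
Proof.
have p0 : p 0 = 0 by rewrite -(scale0r x) pZ /=; ring.
by have := p_par x x; rewrite /polar subrr p0; lra.
Qed.

Lemma polar_i x y : polar ('i *: x) ('i *: y) = polar x y.
Proof. by rewrite /polar -scalerDr -scalerBr !pZ /=; congr (_ / 4); ring. Qed.

Lemma polar_il x y : polar ('i *: x) y = - polar x ('i *: y).
Proof.
rewrite -polar_i scalerA -expr2 sqr_i.
have -> : -1 *: x = (-1)%:C *: x by rewrite rmorphN.
by rewrite polarZl mulN1r.
Qed.

Lemma pD x y : p (x + y) = p x + p y + 2 * polar x y.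
Proof. by have := p_par x y; rewrite /polar; lra. Qed.

Lemma polar_CS x y : polar x y ^+ 2 <= p x * p y.
Proof.
have h a b : 0 <= a ^+ 2 * p x + b ^+ 2 * p y + 2 * (a * (b * polar x y)).
  rewrite -(pZr a) -(pZr b) -[b * polar x y]mulrC.
  have := p_ge0 (a%:C *: x + b%:C *: y).
  by rewrite pD polarZl polarC polarZl (polarC y) [_ * b]mulrC.
have [py0|pyn] := eqVneq (p y) 0.
  have [->|B0] := eqVneq (polar x y) 0; first by rewrite expr0n mulr_ge0.
  (* With [p y = 0] the quadratic form is affine in the second coefficient; this choice gives it the
     value -1. *)
  have := h 1 (- (p x + 1) / (2 * polar x y)).
  rewrite py0 mulr0 addr0.
  suff -> : 2 * (1 * (- (p x + 1) / (2 * polar x y) * polar x y)) = - (p x + 1).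
    lra.
  by field.
have py : 0 < p y by rewrite lt_def pyn p_ge0.
have := h (p y) (- polar x y).
suff -> : p y ^+ 2 * p x + (- polar x y) ^+ 2 * p y +
  2 * (p y * (- polar x y * polar x y)) = p y * (p x * p y - polar x y ^+ 2).
  by rewrite pmulr_rge0 // subr_ge0.
ring.
Qed.

Lemma sqrt_p_triangle x y :
  Num.sqrt (p (x + y)) <= Num.sqrt (p x) + Num.sqrt (p y).
Proof.
rewrite -(@ler_pXn2r _ 2) ?nnegrE ?addr_ge0 ?sqrtr_ge0 //.
rewrite sqrrD !sqr_sqrtr // pD -mulr_natl.
have : polar x y <= Num.sqrt (p x) * Num.sqrt (p y).
  rewrite -sqrtrM //; apply: le_trans (ler_norm _) _.
  by rewrite -sqrtr_sqr ler_sqrt ?mulr_ge0 // polar_CS.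
lra.
Qed.

(** Conjugate-linearity in the second argument forces the imaginary part at [(x, y)] to be the real
    part at [(x, 'i *: y)]. *)
Definition cdot x y : R[i] := polar x y +i* polar x ('i *: y).

Lemma cdot_linearl u : scalar (cdot^~ u).
Proof.
move=> [a b] x y; rewrite /cdot.
have e v : polar ((a +i* b) *: x + y) v =
    a * polar x v - b * polar x ('i *: v) + polar y v.
  rewrite polarDl; congr (_ + _).
  have -> : (a +i* b) *: x = a%:C *: x + b%:C *: ('i *: x).
    by rewrite scalerA -scalerDl; congr (_ *: _); rewrite [LHS]complexE /= mulrC.
  by rewrite polarDl !polarZl polar_il mulrN.
rewrite !e scalerA -expr2 sqr_i.
have -> : -1 *: u = (-1)%:C *: u by rewrite rmorphN.
rewrite (polarC x ((-1)%:C *: u)) polarZl (polarC u).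
rewrite [RHS]/=; simpc => /=.
by apply/eqP; rewrite eq_complex /=; apply/andP; split; apply/eqP; ring.
Qed.

Lemma cdot_conj x y : cdot x y = (-1) ^+ false * Num.conj (cdot y x).
Proof.
rewrite expr0 mul1r /cdot -[RHS]/(polar y x -i* polar y ('i *: x)).
by rewrite (polarC y x) (polarC y ('i *: x)) polar_il opprK.
Qed.

Lemma cdot_linearr u : linear_for (Num.conj \; *%R) (cdot u).
Proof.
move=> a x y; have := cdot_conj u (a *: x + y); rewrite expr0 mul1r => ->.
rewrite (cdot_linearl u a x y) rmorphD rmorphM /=.
by rewrite (cdot_conj u x) (cdot_conj u y) expr0 !mul1r.
Qed.

Lemma cdotxx x : cdot x x = (p x)%:C.
Proof.
by rewrite /cdot polarxx; congr Complex; have := polar_il x x; rewrite polarC; lra.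
Qed.

End JordanVonNeumann.

(** * Reproducing kernel Hilbert spaces *)

Lemma conjc_realM (R : realType) (c : R) (z : R[i]) :
  conjc (c%:C * z) = c%:C * conjc z.
Proof.
case: z => a b; apply/eqP; rewrite eq_complex /=.
by apply/andP; split; apply/eqP; ring.
Qed.

Section FormalSums.
Variables (R : realType) (X : Type).
Implicit Types (K : X -> X -> R) (t u : seq (R[i] * X)) (f g : X -> R[i]).

Definition evs t f : R := complex.Re (\sum_(a <- t) a.1 * f a.2).

(** The real inner product of formal sums in which [(a, x)] stands for [conjc a] times the kernel
    section at [x]. *)
Definition gramian K t u : R :=
  \sum_(a <- t) \sum_(b <- u) complex.Re (a.1 * conjc b.1) * K a.2 b.2.

Definition scales (z : R[i]) t := [seq (z * a.1, a.2) | a <- t].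

Lemma evsE t f : evs t f = \sum_(a <- t) complex.Re (a.1 * f a.2).
Proof. by rewrite /evs raddf_sum. Qed.

Lemma evs_cat t u f : evs (t ++ u) f = evs t f + evs u f.
Proof. by rewrite !evsE big_cat. Qed.

Lemma evsD t f g : evs t (f + g) = evs t f + evs t g.
Proof.
by rewrite !evsE -big_split; apply: eq_bigr => a _; rewrite /= mulrDr raddfD.
Qed.

Lemma evs_scale (z : R[i]) t f : evs (scales z t) f = evs t (z *: f).
Proof.
by rewrite !evsE big_map; apply: eq_bigr => a _; rewrite /= mulrCA mulrA.
Qed.

Lemma evs_real (c : R) t f : evs t (c%:C *: f) = c * evs t f.
Proof.
rewrite !evsE mulr_sumr; apply: eq_bigr => a _.
rewrite -[(c%:C *: f) a.2]/(c%:C * f a.2).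
by case: (a.1) (f a.2) => [x y] [x' y'] /=; ring.
Qed.

Lemma gramian_catl K t t' u :
  gramian K (t ++ t') u = gramian K t u + gramian K t' u.
Proof. by rewrite /gramian big_cat. Qed.

Lemma gramian_catr K t u u' :
  gramian K t (u ++ u') = gramian K t u + gramian K t u'.
Proof. by rewrite /gramian -big_split; apply: eq_bigr => a _; rewrite big_cat. Qed.

Lemma gramian_scale K (z w : R[i]) t u :
  gramian K (scales z t) (scales w u) = gramian K (scales (z * conjc w) t) u.
Proof.
rewrite /gramian !big_map; apply: eq_bigr => a _; rewrite big_map.
apply: eq_bigr => b _; congr (complex.Re _ * _) => /=.
by rewrite rmorphM; ring.
Qed.

Lemma gramian_real K (a : R) t u : gramian K (scales a%:C t) u = a * gramian K t u.
Proof.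
rewrite /gramian big_map mulr_sumr; apply: eq_bigr => b _.
rewrite mulr_sumr; apply: eq_bigr => c _ /=; rewrite mulrA.
by congr (_ * _); case: (b.1) (c.1) => [x y] [x' y'] /=; ring.
Qed.

End FormalSums.

Record psdKernel (R : realType) (X : Type) := PsdKernel {
  kernel_fun :> X -> X -> R;
  kernel_sym : forall x y, kernel_fun x y = kernel_fun y x;
  kernel_psd : forall t, 0 <= gramian kernel_fun t t
}.

Section RkhsNorm.
Variables (R : realType) (X : Type) (K : psdKernel R X).
Implicit Types (t u : seq (R[i] * X)) (f g : X -> R[i]).

(* [2 Re <t, f> - |t|^2] is maximal, with value [|f|^2], when [t] represents   *)
(* [f]; so [qnorm f] is the squared norm of [f] in the reproducing kernel      *)
(* Hilbert space of [K], and [rkhs_finite f] says that [f] belongs to it.      *)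
Definition test_values f : set R := range (fun t => 2 * evs t f - gramian K t t).

Definition rkhs_finite f : bool := `[< has_ubound (test_values f) >].

Definition qnorm f : R := sup (test_values f).

Let values0 f : test_values f !=set0.
Proof. by exists (2 * evs [::] f - gramian K [::] [::]), [::]. Qed.

Lemma qnorm_ub f t : rkhs_finite f -> 2 * evs t f - gramian K t t <= qnorm f.
Proof. by move=> /asboolP fK; apply: ub_le_sup => //; exists t. Qed.

Lemma qnorm_le f (C : R) : (forall t, 2 * evs t f - gramian K t t <= C) ->
  rkhs_finite f /\ qnorm f <= C.
Proof.
move=> h; have hu : ubound (test_values f) C by move=> _ [t _ <-].
by split; [apply/asboolP; exists C | apply: ge_sup].
Qed.

Lemma qnorm_ge0 f : rkhs_finite f -> 0 <= qnorm f.
Proof.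
move=> fK; apply: le_trans (qnorm_ub [::] fK).
by rewrite /gramian /evs !big_nil /=; lra.
Qed.

Lemma qnormZ_le (z : R[i]) f : rkhs_finite f ->
  rkhs_finite (z *: f) /\
  qnorm (z *: f) <= (complex.Re z ^+ 2 + complex.Im z ^+ 2) * qnorm f.
Proof.
move=> fK; set n := _ + _; apply: qnorm_le => t.
have [z0|zn0] := eqVneq z 0.
  rewrite /n z0 scale0r /= expr0n addr0 mul0r.
  have -> : evs t 0 = 0 by rewrite evsE big1 // => a _; rewrite mulr0.
  by have := kernel_psd K t; lra.
have n0 : 0 < n.
  rewrite /n lt_def addr_ge0 ?sqr_ge0 // andbT.
  apply: contraNneq zn0 => /eqP; rewrite paddr_eq0 ?sqr_ge0 // !sqrf_eq0.
  by move=> zz; rewrite eq_complex.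
have zzE : z * conjc z = n%:C.
  by rewrite /n; case: (z) => a b; simpc; congr Complex => /=; ring.
(* Testing [z *: f] on [t] amounts to testing [f] on [n^-1 z t], up to the factor [n], the squared
   modulus of [z]. *)
have := qnorm_ub (scales (n^-1%:C * z) t) fK.
have -> : evs (scales (n^-1%:C * z) t) f = n^-1 * evs t (z *: f).
  by rewrite evs_scale -scalerA evs_real.
have -> : gramian K (scales (n^-1%:C * z) t) (scales (n^-1%:C * z) t) =
    n^-1 * gramian K t t.
  rewrite gramian_scale -gramian_real; congr (gramian K (scales _ t) t).
  rewrite conjc_realM mulrACA zzE -!rmorphM; congr (_%:C).
  by field; rewrite gt_eqF.
by rewrite mulrCA -mulrBr ler_pdivrMl.
Qed.

Lemma qnormZ (z : R[i]) f : rkhs_finite f ->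
  qnorm (z *: f) = (complex.Re z ^+ 2 + complex.Im z ^+ 2) * qnorm f.
Proof.
move=> fK; have [zfK zle] := qnormZ_le z fK; apply/eqP; rewrite eq_le zle /=.
have [z0|zn0] := eqVneq z 0.
  by rewrite z0 /= expr0n addr0 mul0r qnorm_ge0 // -z0.
have := (qnormZ_le z^-1 zfK).2; rewrite scalerA mulVf // scale1r.
set n := complex.Re z ^+ 2 + complex.Im z ^+ 2.
have n0 : n != 0.
  apply: contraNneq zn0 => /eqP; rewrite paddr_eq0 ?sqr_ge0 // !sqrf_eq0.
  by move=> zz; rewrite eq_complex.
have -> : complex.Re z^-1 ^+ 2 + complex.Im z^-1 ^+ 2 = n^-1.
  by move: n0; rewrite /n; case: (z) => a b /= ?; field.
move=> h; rewrite mulrC -ler_pdivlMr ?[qnorm _ / n]mulrC //.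
by rewrite lt_def n0 addr_ge0 ?sqr_ge0.
Qed.

Let half_test t f : rkhs_finite f ->
  2 * evs t f - gramian K t t / 2 <= 2 * qnorm f.
Proof.
move=> fK; have := qnorm_ub (scales (2^-1)%:C t) fK.
have -> : evs (scales (2^-1)%:C t) f = 2^-1 * evs t f.
  by rewrite evs_scale evs_real.
rewrite gramian_scale conjc_real -rmorphM gramian_real; lra.
Qed.

Let scalesN t f : evs (scales (-1)%:C t) f = - evs t f.
Proof.
by rewrite evs_scale evs_real mulN1r.
Qed.

Lemma gramianC t u : gramian K t u = gramian K u t.
Proof.
rewrite /gramian exchange_big; apply: eq_bigr => a _; apply: eq_bigr => b _.
rewrite kernel_sym; congr (_ * _).
by case: (a.1) (b.1) => [x y] [x' y'] /=; ring.
Qed.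

(* The substitution (t, u) |-> (t + u, t - u) of formal sums, under which the  *)
(* parallelogram law for the Gramian dualizes to one for its conjugate form.   *)
Let par_test t u f g : rkhs_finite f -> rkhs_finite g ->
  2 * evs t (f + g) - gramian K t t + (2 * evs u (f + - g) - gramian K u u)
    <= 2 * qnorm f + 2 * qnorm g.
Proof.
move=> fK gK.
have h1 := half_test (t ++ u) fK; have h2 := half_test (t ++ scales (-1)%:C u) gK.
rewrite evs_cat gramian_catl !gramian_catr in h1.
rewrite evs_cat scalesN gramian_catl !gramian_catr gramian_real in h2.
rewrite gramian_scale conjc_real -rmorphM gramian_real in h2.
rewrite (gramianC t (scales _ _)) gramian_real in h2.
have eN : evs u (- g) = - evs u g.
  by rewrite !evsE -sumrN; apply: eq_bigr => a _ /=; rewrite mulrN raddfN.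
rewrite !evsD eN; rewrite (gramianC u t) in h1 h2; lra.
Qed.

Let finiteN g : rkhs_finite g -> rkhs_finite (- g).
Proof. by rewrite -scaleN1r => /(@qnormZ_le (-1))[]. Qed.

Lemma rkhs_finiteD f g : rkhs_finite f -> rkhs_finite g -> rkhs_finite (f + g).
Proof.
move=> fK gK; apply: (@qnorm_le _ (2 * qnorm f + 2 * qnorm g) _).1 => t.
have := par_test t [::] fK gK.
by rewrite {2}/evs {2}/gramian !big_nil /=; lra.
Qed.

Let par_le f g : rkhs_finite f -> rkhs_finite g ->
  qnorm (f + g) + qnorm (f - g) <= 2 * qnorm f + 2 * qnorm g.
Proof.
move=> fK gK; rewrite -lerBrDr.
apply: (qnorm_le _).2 => t; rewrite lerBrDr -lerBrDl.
apply: (qnorm_le _).2 => u; rewrite lerBrDl.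
exact: par_test.
Qed.

Lemma qnorm_par f g : rkhs_finite f -> rkhs_finite g ->
  qnorm (f + g) + qnorm (f - g) = 2 * qnorm f + 2 * qnorm g.
Proof.
move=> fK gK; apply/eqP; rewrite eq_le par_le //=.
(* The reverse inequality is [par_le] applied to [f + g] and [f - g], whose sum and difference are
   [2 f] and [2 g]. *)
have := par_le (rkhs_finiteD fK gK) (rkhs_finiteD fK (finiteN gK)).
have two h : rkhs_finite h -> qnorm (h + h) = 4 * qnorm h.
  move=> hK; have -> : h + h = 2%:C *: h.
    by rewrite -mulr2n -scaler_nat rmorph_nat.
  by rewrite qnormZ //=; ring.
rewrite [f + g + _]addrACA subrr addr0.
have -> : f + g - (f - g) = g + g.
  by rewrite opprB (addrC f) addrACA subrr addr0.
rewrite !two //; lra.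
Qed.

(** Test [f] on the one-point sums [l * conjc (f x)] at [x]. The best [l] is the inverse of [K x x];
    when [K x x] is 0, a large [l] rules out [f x != 0]. *)
Lemma eval_qnorm f x : rkhs_finite f ->
  complex.Re (f x) ^+ 2 + complex.Im (f x) ^+ 2 <= K x x * qnorm f.
Proof.
move=> fK; set a := _ + _.
have h l : 2 * (l * a) - l ^+ 2 * a * K x x <= qnorm f.
  have := qnorm_ub [:: (l%:C * conjc (f x), x)] fK.
  rewrite evsE /gramian !big_seq1 /= => h; apply: le_trans h.
  rewrite le_eqVlt; apply/orP; left; apply/eqP; rewrite /a.
  by case: (f x) => u v /=; ring.
have k0 : 0 <= K x x.
  by have := kernel_psd K [:: (1, x)]; rewrite /gramian !big_seq1 /=; lra.
have [kx0|kx] := eqVneq (K x x) 0.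
  have [a0|an] := eqVneq a 0; first by rewrite a0 kx0 mul0r.
  have := h ((qnorm f + 1) / (2 * a)).
  have -> : 2 * ((qnorm f + 1) / (2 * a) * a) = qnorm f + 1 by field.
  by rewrite kx0; lra.
have kp : 0 < K x x by rewrite lt_def kx.
rewrite -ler_pdivrMl //; apply: le_trans (h (K x x)^-1).
by rewrite le_eqVlt; apply/orP; left; apply/eqP; field.
Qed.

End RkhsNorm.

Section RkhsSpace.
Variables (R : realType) (X : Type) (K : psdKernel R X).

Record rkhs := Rkhs {
  rkhs_fun : X -> R[i];
  rkhs_funP : rkhs_fun \in rkhs_finite K
}.

HB.instance Definition _ := [isSub for rkhs_fun].
HB.instance Definition _ := [Choice of rkhs by <:].

Lemma rkhs_submod_closed : submod_closed (rkhs_finite K).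
Proof.
split=> [|a f g fK gK].
  apply: (@qnorm_le _ _ K _ 0 _).1 => t.
  have -> : evs t 0 = 0 by rewrite evsE big1 // => a _; rewrite mulr0.
  by have := kernel_psd K t; lra.
by apply: rkhs_finiteD => //; exact: (qnormZ_le _ _).1.
Qed.

HB.instance Definition _ :=
  GRing.isSubmodClosed.Build R[i] (X -> R[i]) (rkhs_finite K) rkhs_submod_closed.
HB.instance Definition _ := [SubChoice_isSubLmodule of rkhs by <:].

Implicit Types f g : rkhs.

Definition sqnorm f := qnorm K (rkhs_fun f).

Lemma sqnorm_ge0 f : 0 <= sqnorm f.
Proof. exact/qnorm_ge0/rkhs_funP. Qed.

Lemma sqnorm_par f g : sqnorm (f + g) + sqnorm (f - g) = 2 * sqnorm f + 2 * sqnorm g.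
Proof. by apply: qnorm_par; exact: rkhs_funP. Qed.

Lemma sqnormZ (z : R[i]) f :
  sqnorm (z *: f) = (complex.Re z ^+ 2 + complex.Im z ^+ 2) * sqnorm f.
Proof. by apply: qnormZ; exact: rkhs_funP. Qed.

Lemma sqnorm_eq0 f : sqnorm f = 0 -> f = 0.
Proof.
move=> f0; apply/val_inj/funext => x /=.
have := eval_qnorm x (rkhs_funP f); rewrite -/(sqnorm f) f0 mulr0.
set a := complex.Re _; set b := complex.Im _ => ab.
have a2 := sqr_ge0 a; have b2 := sqr_ge0 b.
apply/eqP; rewrite eq_complex -/a -/b /= -(sqrf_eq0 a) -(sqrf_eq0 b).
by apply/andP; split; apply/eqP; lra.
Qed.

Definition rkhs_norm f : R[i] := (Num.sqrt (sqnorm f))%:C.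

Lemma rkhs_ler_normD f g : rkhs_norm (f + g) <= rkhs_norm f + rkhs_norm g.
Proof.
rewrite /rkhs_norm -rmorphD lecR.
exact: (sqrt_p_triangle sqnorm_ge0 sqnorm_par sqnormZ).
Qed.

Lemma rkhs_normZ (z : R[i]) f : rkhs_norm (z *: f) = `|z| * rkhs_norm f.
Proof.
by rewrite /rkhs_norm sqnormZ sqrtrM ?addr_ge0 ?sqr_ge0 // rmorphM normc_def.
Qed.

Lemma rkhs_norm0_eq0 f : rkhs_norm f = 0 -> f = 0.
Proof.
move=> /complexI /eqP; rewrite sqrtr_eq0 => f0.
by apply/sqnorm_eq0/eqP; rewrite eq_le f0 sqnorm_ge0.
Qed.

HB.instance Definition _ := Lmodule_isNormed.Build R[i] rkhs
  rkhs_ler_normD rkhs_normZ rkhs_norm0_eq0.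

Lemma rkhs_normE f : `|f| = (Num.sqrt (sqnorm f))%:C.
Proof. by []. Qed.

Lemma norm_lt_sqnorm f (e : R) : 0 < e -> `|f| < e%:C -> sqnorm f < e ^+ 2.
Proof.
move=> e0; rewrite rkhs_normE ltcR => h.
rewrite -(sqr_sqrtr (sqnorm_ge0 f)).
by rewrite ltr_pXn2r // nnegrE ?sqrtr_ge0 // ltW.
Qed.

Lemma sqnorm_le_norm f (e : R) : 0 <= e -> sqnorm f <= e ^+ 2 -> `|f| <= e%:C.
Proof.
move=> e0 h; rewrite rkhs_normE lecR -(ger0_norm e0) -sqrtr_sqr.
by rewrite ler_sqrt ?sqr_ge0.
Qed.

(** Point evaluations are Lipschitz. The constant [K x x + 1] dominates the square root of [K x x]
    and is positive even if [K x x] vanishes. *)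
Lemma re_eval_bound f x (e : R) : 0 < e -> `|f| < e%:C ->
  `|complex.Re (rkhs_fun f x)| < (K x x + 1) * e /\
  `|complex.Im (rkhs_fun f x)| < (K x x + 1) * e.
Proof.
move=> e0 /(norm_lt_sqnorm e0) fe.
have := eval_qnorm x (rkhs_funP f); rewrite -/(sqnorm f).
have k0 : 0 <= K x x.
  by have := kernel_psd K [:: (1, x)]; rewrite /gramian !big_seq1 /=; lra.
have f0 := sqnorm_ge0 f.
set a := complex.Re _; set b := complex.Im _ => ab.
have a2 := sqr_ge0 a; have b2 := sqr_ge0 b.
have M0 : 0 < (K x x + 1) * e by apply: mulr_gt0 => //; lra.
have ke : K x x * sqnorm f < ((K x x + 1) * e) ^+ 2.
  apply: (@le_lt_trans _ _ (K x x * e ^+ 2)); first by rewrite ler_wpM2l // ltW.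
  rewrite exprMn ltr_pM2r ?exprn_gt0 //; nra.
by split; rewrite -(ltr_pXn2r (n := 2)) ?nnegrE ?normr_ge0 ?(ltW M0) //
  real_normK ?num_real //; lra.
Qed.

End RkhsSpace.

Lemma cvg_sum_seq (R : realType) (T I : Type) (F : set_system T) {FF : Filter F} (s : seq I)
    (u : I -> T -> R) (l : I -> R) :
  (forall i, u i @ F --> l i) ->
  (fun x => \sum_(i <- s) u i x) @ F --> \sum_(i <- s) l i.
Proof.
move=> ul; elim: s => [|i s IH].
  by rewrite big_nil; under eq_fun do rewrite big_nil; exact: cvg_cst.
by rewrite big_cons; under eq_fun do rewrite big_cons; exact: cvgD.
Qed.


(** * Completeness and the Hilbert space structure *)

Section RkhsComplete.
Variables (R : realType) (X : Type) (K : psdKernel R X).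
Local Notation H := (rkhs K).

Lemma cvg_evs (T : Type) (F : set_system T) {FF : Filter F}
    (f : T -> X -> R[i]) (l : X -> R[i]) t :
  (forall x, complex.Re (f n x) @[n --> F] --> complex.Re (l x)) ->
  (forall x, complex.Im (f n x) @[n --> F] --> complex.Im (l x)) ->
  evs t (f n) @[n --> F] --> evs t l.
Proof.
move=> fR fI; rewrite evsE; under eq_fun do rewrite evsE.
apply: cvg_sum_seq => -[[a b] x] /=.
have e (z : R[i]) : complex.Re ((a +i* b) * z) =
  a * complex.Re z - b * complex.Im z by case: z.
rewrite e; under eq_fun do rewrite e.
by apply: cvgB; apply: cvgM => //; exact: cvg_cst.
Qed.

Lemma cauchy_image_cvg (F : set_system H) (phi : H -> R) (M : R) :
  ProperFilter F -> cauchy F -> 0 < M ->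
  (forall f g (e : R), 0 < e -> `|f - g| < e%:C -> `|phi f - phi g| < M * e) ->
  cvg (phi @ F).
Proof.
move=> FF cF M0 phiM; apply/cauchy_cvgP/cauchy_exP => e e0.
have e'0 : 0 < (e / M)%:C by rewrite ltcR divr_gt0.
have [f Ff] := (iffLR (cauchyP _)) cF _ e'0.
exists (phi f); suff : F (phi @^-1` ball (phi f) e) by [].
apply: filterS Ff => g; rewrite /preimage -ball_normE /= => fg.
have := phiM f g (e / M); rewrite [M * _]mulrC divfK ?gt_eqF //.
by apply => //; rewrite divr_gt0.
Qed.

Lemma rkhs_cauchy_cvg (F : set_system H) :
  ProperFilter F -> cauchy F -> cvg F.
Proof.
move=> FF cF.
have k0 x : 0 < K x x + 1.
  by have := kernel_psd K [:: (1, x)]; rewrite /gramian !big_seq1 /=; lra.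
have cR x : cvg (complex.Re (rkhs_fun f x) @[f --> F]).
  apply: (cauchy_image_cvg FF cF (k0 x)) => f g e e0 fg.
  by have [+ _] := re_eval_bound x e0 fg; rewrite -raddfB.
have cI x : cvg (complex.Im (rkhs_fun f x) @[f --> F]).
  apply: (cauchy_image_cvg FF cF (k0 x)) => f g e e0 fg.
  by have [_ +] := re_eval_bound x e0 fg; rewrite -raddfB.
pose l x : R[i] := lim (complex.Re (rkhs_fun f x) @[f --> F]) +i*
  lim (complex.Im (rkhs_fun f x) @[f --> F]).
have cE t : evs t (rkhs_fun f) @[f --> F] --> evs t l by exact: cvg_evs.
(* Each test value involves finitely many points, so it is continuous under pointwise convergence;
   the squared norm, a supremum of test values, is therefore lower semicontinuous. *)
have near_l (e : R) f : 0 < e -> F (ball f e%:C) ->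
    (l - rkhs_fun f) \in rkhs_finite K /\ qnorm K (l - rkhs_fun f) <= e ^+ 2.
  move=> e0 Ff; apply: qnorm_le => t.
  have eB (g : X -> R[i]) : evs t (g - rkhs_fun f) = evs t g - evs t (rkhs_fun f).
    rewrite evsD; congr (_ + _); rewrite !evsE -sumrN.
    by apply: eq_bigr => a _; rewrite mulrN raddfN.
  rewrite eB.
  have hl : 2 * (evs t (rkhs_fun g) - evs t (rkhs_fun f)) - gramian K t t
      @[g --> F] --> 2 * (evs t l - evs t (rkhs_fun f)) - gramian K t t.
    apply: cvgB; last exact: cvg_cst.
    apply: cvgM; first exact: cvg_cst.
    by apply: cvgB; [exact: cE | exact: cvg_cst].
  apply: (cvgr_to_le hl).
  apply: filterS Ff => g; rewrite -ball_normE /= distrC => /(norm_lt_sqnorm e0) /ltW.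
  apply: le_trans; rewrite -eB; apply: qnorm_ub; exact: rkhs_funP (g - f).
have [f1 Ff1] := (iffLR (cauchyP _)) cF 1%:C ltr01.
have lK : l \in rkhs_finite K.
  rewrite -(subrK (rkhs_fun f1) l).
  by apply: rkhs_finiteD; [exact: (near_l 1 f1 ltr01 Ff1).1 | exact: rkhs_funP].
apply/cvg_ex; exists (Rkhs lK); apply/fcvgrPdist_lt => e e0.
have eE : e = (complex.Re e)%:C.
  by case: e e0 => a b; rewrite ltcE /= => /andP[/eqP -> _].
have r0 : 0 < complex.Re e by rewrite eE ltcR in e0.
have e30 : 0 < (complex.Re e / 3)%:C by rewrite ltcR; lra.
have [f Ff] := (iffLR (cauchyP _)) cF _ e30.
have e3 : 0 < complex.Re e / 3 by lra.
have lf : `|Rkhs lK - f| <= (complex.Re e / 3)%:C.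
  by apply: sqnorm_le_norm; [exact: ltW | exact: (near_l _ f e3 Ff).2].
apply: filterS Ff => g; rewrite -ball_normE /= => fg.
rewrite -(subrKA f); apply: le_lt_trans (ler_normD _ _) _.
apply: lt_le_trans (ler_ltD lf fg) _.
by rewrite -rmorphD eE lecR /=; lra.
Qed.

HB.instance Definition _ := Uniform_isComplete.Build (rkhs K) rkhs_cauchy_cvg.

Definition rkhs_dot : H -> H -> R[i] := cdot (@sqnorm R X K).

Let dot_bilinear : bilinear_for *%R (Num.conj \; *%R) rkhs_dot.
Proof.
split=> u.
  exact: (cdot_linearl (@sqnorm_ge0 _ _ K) (@sqnorm_par _ _ K) (@sqnormZ _ _ K)).
exact: (cdot_linearr (@sqnorm_ge0 _ _ K) (@sqnorm_par _ _ K) (@sqnormZ _ _ K)).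
Qed.

HB.instance Definition _ := bilinear_isBilinear.Build R[i] H H R[i] *%R
  (Num.conj \; *%R) rkhs_dot dot_bilinear.

Let dot_hermitian (f g : H) :
  rkhs_dot f g = (-1) ^+ false * Num.conj (rkhs_dot g f).
Proof. exact: (cdot_conj (@sqnorm_ge0 _ _ K) (@sqnorm_par _ _ K) (@sqnormZ _ _ K)). Qed.

HB.instance Definition _ := isHermitianSesquilinear.Build R[i] H false Num.conj
  rkhs_dot dot_hermitian.

Lemma rkhs_dotxx (f : H) : rkhs_dot f f = (sqnorm f)%:C.
Proof. exact: (cdotxx (@sqnorm_ge0 _ _ K) (@sqnorm_par _ _ K) (@sqnormZ _ _ K)). Qed.

Let dot_gt0 (f : H) : f != 0 -> 0 < rkhs_dot f f.
Proof.
move=> f0; rewrite rkhs_dotxx ltcR lt_def sqnorm_ge0 andbT.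
by apply: contra_neq f0; exact: sqnorm_eq0.
Qed.

HB.instance Definition _ := isDotProduct.Build R[i] H rkhs_dot dot_gt0.

Let dot_norm (f : H) : rkhs_dot f f = `|f| ^+ 2.
Proof. by rewrite rkhs_dotxx rkhs_normE -rmorphXn sqr_sqrtr ?sqnorm_ge0. Qed.

Definition rkhsHilbert : hilbertType R := @HilbertType R H rkhs_dot dot_norm.

End RkhsComplete.

(** * Spectral gap *)

Lemma generating_set_ind (G : groupType) (S : {fset G}) (P : G -> Prop) :
  generating_set S -> P 1%g -> (forall s, s \in S -> P s) ->
  (forall u v, P u -> P v -> P (u * v^-1)%g) -> forall g, P g.
Proof.
move=> S_gen P1 PS PM g.
have : [set: G] g by [].
rewrite -S_gen => /(_ [set g | P g]); apply; split; last by move=> s /PS.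
by split; [rewrite inE | move=> u v; rewrite !inE; exact: PM].
Qed.

Lemma expr_lt_ex (R : realType) (rho C e : R) : 0 <= rho < 1 -> 0 < e ->
  exists k, C * rho ^+ k < e.
Proof.
move=> /andP[r0 r1] e0.
have /cvgr_lt /(_ e) : C * rho ^+ k @[k --> \oo] --> C * 0.
  by apply: cvgMl_tmp; apply: cvg_expr; rewrite ger0_norm.
by rewrite mulr0 => /(_ e0) [k _ /(_ k (leqnn k))] h; exists k.
Qed.


(** * The underlying real inner product *)

Section RealDot.
Variables (R : realType) (H : hilbertType R).
Implicit Types x y z : H.

Definition rdot x y : R := complex.Re (hdot x y).
Definition rnorm x : R := complex.Re `|x|.

Lemma rnormE x : `|x| = (rnorm x)%:C.
Proof.
by rewrite /rnorm RRe_real // ger0_real.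
Qed.

Lemma rnorm_ge0 x : 0 <= rnorm x.
Proof. by rewrite -ler0c -rnormE normr_ge0. Qed.

Lemma rdotxx x : rdot x x = rnorm x ^+ 2.
Proof. by rewrite /rdot hdot_norm rnormE -rmorphXn. Qed.

Lemma rdot_ge0 x : 0 <= rdot x x.
Proof. by rewrite rdotxx sqr_ge0. Qed.

Lemma rnorm_le x (a : R) : 0 <= a -> rdot x x <= a ^+ 2 -> rnorm x <= a.
Proof. by move=> a0; rewrite rdotxx ler_pXn2r // nnegrE rnorm_ge0. Qed.

Lemma rnorm_triangle x y : rnorm (x + y) <= rnorm x + rnorm y.
Proof. by rewrite -lecR rmorphD /= -!rnormE ler_normD. Qed.

Lemma rnormN x : rnorm (- x) = rnorm x.
Proof. by rewrite /rnorm normrN. Qed.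

Lemma rnorm_eq0 x : rnorm x = 0 -> x = 0.
Proof. by move=> x0; apply/normr0_eq0; rewrite rnormE x0. Qed.

Lemma rdotC x y : rdot x y = rdot y x.
Proof.
have ReJ (z : R[i]) : complex.Re (Num.conj z) = complex.Re z by case: z.
by rewrite /rdot hermC expr0 mul1r; exact: ReJ.
Qed.

Lemma rdotDl x y z : rdot (x + y) z = rdot x z + rdot y z.
Proof. by rewrite /rdot linearDl raddfD. Qed.

Lemma rdotDr x y z : rdot z (x + y) = rdot z x + rdot z y.
Proof. by rewrite rdotC rdotDl !(rdotC _ z). Qed.

Lemma rdotNl x y : rdot (- x) y = - rdot x y.
Proof. by rewrite /rdot linearNl raddfN. Qed.

Lemma rdotNr x y : rdot x (- y) = - rdot x y.
Proof. by rewrite rdotC rdotNl rdotC. Qed.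

Lemma rdotZl (a : R) x y : rdot (a%:C *: x) y = a * rdot x y.
Proof.
have ReZ (z : R[i]) : complex.Re (a%:C * z) = a * complex.Re z.
  by case: z => b c /=; rewrite mul0r subr0.
by rewrite /rdot linearZl_LR; exact: ReZ.
Qed.

Lemma rdotZr (a : R) x y : rdot x (a%:C *: y) = a * rdot x y.
Proof. by rewrite rdotC rdotZl rdotC. Qed.

Lemma rdot0l y : rdot 0 y = 0.
Proof. by rewrite /rdot linear0l. Qed.

Lemma rdot_suml (I : Type) (s : seq I) (u : I -> H) y :
  rdot (\sum_(i <- s) u i) y = \sum_(i <- s) rdot (u i) y.
Proof.
elim: s => [|i s IH]; first by rewrite !big_nil rdot0l.
by rewrite !big_cons rdotDl IH.
Qed.

Lemma rdot_sumr (I : Type) (s : seq I) (u : I -> H) y :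
  rdot y (\sum_(i <- s) u i) = \sum_(i <- s) rdot y (u i).
Proof. by rewrite rdotC rdot_suml; apply: eq_bigr => i _; rewrite rdotC. Qed.

Lemma rdot_amgm x y : `|rdot x y| <= (rdot x x + rdot y y) / 2.
Proof.
have := rdot_ge0 (x + y); have := rdot_ge0 (x - y).
rewrite !(rdotDl, rdotDr, rdotNl, rdotNr) (rdotC y x) ler_norml => h1 h2.
by apply/andP; split; lra.
Qed.

Lemma rdot_sum_le (I : Type) (s : seq I) (u : I -> H) :
  rdot (\sum_(i <- s) u i) (\sum_(i <- s) u i) <=
    (size s)%:R * \sum_(i <- s) rdot (u i) (u i).
Proof.
rewrite rdot_suml; under eq_bigr do rewrite rdot_sumr.
set A := \sum_(i <- s) rdot (u i) (u i).
have e (a : R) : \sum_(i <- s) a = (size s)%:R * a.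
  by rewrite big_const_seq count_predT iter_addr_0 mulr_natl.
have -> : (size s)%:R * A =
    \sum_(i <- s) \sum_(j <- s) (rdot (u i) (u i) + rdot (u j) (u j)) / 2.
  under eq_bigr do rewrite -mulr_suml big_split /= e -/A.
  by rewrite -mulr_suml big_split /= e -mulr_sumr -/A; field.
apply: ler_sum => i _; apply: ler_sum => j _.
exact: le_trans (ler_norm _) (rdot_amgm _ _).
Qed.

Lemma rdot_CS x y : rdot x y ^+ 2 <= rdot x x * rdot y y.
Proof.
have [y0|yn] := eqVneq (rdot y y) 0.
  have -> : y = 0 by apply: rnorm_eq0; apply/eqP; rewrite -sqrf_eq0 -rdotxx y0.
  by rewrite rdotC rdot0l expr0n /= mulr_ge0 ?rdot_ge0.
have yp : 0 < rdot y y by rewrite lt_def yn rdot_ge0.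
have := rdot_ge0 ((rdot y y)%:C *: x - (rdot x y)%:C *: y).
rewrite !(rdotDl, rdotDr, rdotNl, rdotNr, rdotZl, rdotZr) (rdotC y x) => h.
rewrite -subr_ge0 -(pmulr_rge0 _ yp); apply: le_trans h _.
rewrite le_eqVlt; apply/orP; left; apply/eqP; ring.
Qed.

Lemma geometric_cvg (u : nat -> H) (a rho : R) : 0 <= rho < 1 -> 0 <= a ->
  (forall k, rnorm (u k.+1 - u k) <= a * rho ^+ k) ->
  exists l, forall k, rnorm (u k - l) <= a / (1 - rho) * rho ^+ k.
Proof.
move=> r01 a0 hu; have /andP[r0 r1] := r01.
have step k j : rnorm (u (k + j)%N - u k) <= a / (1 - rho) * rho ^+ k.
  (* The factor [1 - rho ^+ j] makes the bound the exact partial geometric sum, so that the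
     induction on [j] closes. *)
  suff : rnorm (u (k + j)%N - u k) <=
      a / (1 - rho) * rho ^+ k * (1 - rho ^+ j).
    move/le_trans; apply; apply: ler_piMr.
      by rewrite mulr_ge0 ?exprn_ge0 // divr_ge0 // subr_ge0 ltW.
    by rewrite gerBl exprn_ge0.
  elim: j => [|j IH].
    by rewrite addn0 subrr /rnorm normr0 expr0 subrr mulr0.
  rewrite -(subrKA (u (k + j)%N)) addnS.
  apply: le_trans (rnorm_triangle _ _) _.
  apply: le_trans (lerD (hu _) IH) _.
  rewrite le_eqVlt; apply/orP; left; apply/eqP; rewrite exprD exprS; field.
  by rewrite subr_eq0 gt_eqF.
have cu : cauchy (u @ \oo).
  apply: cauchy_exP => e e0.
  have eE : e = (complex.Re e)%:C.
    by case: e e0 => b c; rewrite ltcE /= => /andP[/eqP -> _].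
  have re0 : 0 < complex.Re e by rewrite eE ltcR in e0.
  have [k hk] := expr_lt_ex (a / (1 - rho)) r01 re0.
  exists (u k); exists k => // n /= kn; rewrite -ball_normE /=.
  rewrite distrC rnormE eE ltcR; apply: le_lt_trans hk.
  by rewrite -(subnKC kn).
have [l ul] := (iffLR (cvg_ex _)) (cauchy_cvg _ cu).
exists l => k; rewrite leNgt; apply/negP => h.
set b := _ * _ in h; set c := rnorm _ in h.
have e0 : 0 < (c - b)%:C by rewrite ltcR subr_gt0.
have [n _ hn] := (iffLR (cvgrPdist_lt _ _)) ul _ e0.
have := hn (k + n)%N (leq_addl _ _); rewrite /= rnormE ltcR => h1.
have := step k n; rewrite -/b => h2.
have : c <= rnorm (l - u (k + n)%N) + rnorm (u (k + n)%N - u k).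
  rewrite /c -[u k - l]opprB rnormN.
  by rewrite -{1}(subrKA (u (k + n)%N)) rnorm_triangle.
lra.
Qed.

End RealDot.

Lemma sum_symmetric_set (R : realType) (G : groupType) (S : {fset G})
    (phi : G -> R) : symmetric_set S ->
  \sum_(s <- S) phi (s^-1)%g = \sum_(s <- S) phi s.
Proof.
move=> S_sym; rewrite -(big_map (fun s => s^-1)%g xpredT phi); apply: perm_big.
apply: uniq_perm.
- by rewrite map_inj_uniq ?fset_uniq //; exact: invg_inj.
- exact: fset_uniq.
- by move=> x; rewrite [in RHS]S_sym; apply/mapP/imfsetP => -[s sS ->]; exists s.
Qed.

(** * Energy and gradient descent for a unitary representation *)

Section Laplacian.
Variables (R : realType) (G : groupType) (S : {fset G}) (H : hilbertType R).
Variables (pi : G -> {linear H -> H}).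
Hypotheses (S_sym : symmetric_set S) (pi_unitary : unitary_rep pi).
Implicit Types x y : H.

(* Not divided by [#|` S|]: it is [#|` S|] times [1 - P].                      *)
Definition laplacian x : H := \sum_(s <- S) (x - pi s x).
Definition energy x : R := rdot (laplacian x) x.
Local Notation m := ((size S)%:R : R).

Lemma rdot_rep g x y : rdot (pi g x) (pi g y) = rdot x y.
Proof. by case: pi_unitary => _ _ h; rewrite /rdot h. Qed.

Lemma rep_mul g h x : pi (g * h)%g x = pi g (pi h x).
Proof. by case: pi_unitary. Qed.

Lemma rep_one x : pi 1%g x = x.
Proof. by case: pi_unitary. Qed.

Lemma rdot_repl g x y : rdot (pi g x) y = rdot x (pi (g^-1)%g y).
Proof. by rewrite -(rdot_rep g^-1%g) -rep_mul mulVg rep_one. Qed.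

Lemma laplacian_sym x y : rdot (laplacian x) y = rdot x (laplacian y).
Proof.
rewrite rdot_suml rdot_sumr.
under eq_bigr do rewrite rdotDl rdotNl.
under [RHS]eq_bigr do rewrite rdotDr rdotNr.
rewrite !big_split /=; congr (_ + _).
rewrite -[RHS](sum_symmetric_set _ S_sym).
by apply: eq_bigr => s _; rewrite rdot_repl.
Qed.

Lemma laplacianB x y : laplacian (x - y) = laplacian x - laplacian y.
Proof.
rewrite /laplacian -sumrN -big_split; apply: eq_bigr => s _ /=.
by rewrite linearB /= !opprB [LHS]addrACA [RHS]addrACA (addrC (- y)).
Qed.

Lemma laplacianZ (a : R[i]) x : laplacian (a *: x) = a *: laplacian x.
Proof.
rewrite /laplacian scaler_sumr; apply: eq_bigr => s _.
by rewrite linearZ /= scalerBr.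
Qed.

Lemma dirichlet_energy x :
  energy x = (\sum_(s <- S) rdot (x - pi s x) (x - pi s x)) / 2.
Proof.
rewrite /energy rdot_suml mulr_suml; apply: eq_bigr => s _.
rewrite !(rdotDl, rdotDr, rdotNl, rdotNr) rdot_rep (rdotC (pi s x)).
by field.
Qed.

Lemma energy_ge0 x : 0 <= energy x.
Proof.
rewrite dirichlet_energy divr_ge0 // sumr_ge0 // => s _; exact: rdot_ge0.
Qed.

Lemma laplacian_le_energy x : rdot (laplacian x) (laplacian x) <= 2 * m * energy x.
Proof.
apply: le_trans (rdot_sum_le _ _) _; rewrite dirichlet_energy.
by rewrite le_eqVlt; apply/orP; left; apply/eqP; field.
Qed.

Lemma energy_le_norm x : energy x <= 2 * m * rdot x x.
Proof.
rewrite /energy rdot_suml.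
have -> : 2 * m * rdot x x = \sum_(s <- S) (2 * rdot x x).
  by rewrite big_const_seq count_predT iter_addr_0 -mulr_natl; ring.
apply: ler_sum => s _; rewrite rdotDl rdotNl.
have := rdot_amgm (pi s x) x; rewrite rdot_rep ler_norml => /andP[h _]; lra.
Qed.

(** Expanding the quadratic energy gives [- 2 c |D x|^2 + c^2 <D D x, D x>] with [c = (2 * m)^-1],
    and [energy_le_norm] at [D x] bounds the last term by [c |D x|^2]. *)
Lemma energy_gradient_step x : (0 < size S)%N ->
  energy (x - (2 * m)^-1%:C *: laplacian x) <=
    energy x - rdot (laplacian x) (laplacian x) / (2 * m).
Proof.
move=> S0; have m0 : 0 < m by rewrite ltr0n.
rewrite /energy laplacianB laplacianZ.
rewrite !(rdotDl, rdotDr, rdotNl, rdotNr, rdotZl, rdotZr).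
rewrite (laplacian_sym (laplacian x) x).
have := energy_le_norm (laplacian x); rewrite /energy.
set a := rdot (laplacian (laplacian x)) _; set b := rdot (laplacian x) (laplacian x).
move=> ab.
set c := (2 * m)^-1.
have : c * (c * a) <= c * b.
  by rewrite ler_pM2l ?invr_gt0 ?mulr_gt0 // ler_pdivrMl ?mulr_gt0.
lra.
Qed.

Hypothesis S_gen : generating_set S.
Hypothesis S_gt0 : (0 < size S)%N.

(* Under [gap] the iterates of [energy_gradient_step] have geometrically       *)
(* decaying energy, so they converge to an invariant vector, that is, to 0.    *)
Lemma spectral_gap x (rho a : R) : 0 <= rho < 1 -> 0 <= a ->
  (forall y, 2 * m * (1 - rho ^+ 2) * energy y <=
     rdot (laplacian y) (laplacian y)) ->
  (forall y, invariant_vector pi y -> y = 0) ->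
  energy x <= 2 * m * a ^+ 2 -> rnorm x <= a / (1 - rho).
Proof.
move=> r01 a0 gap noinv Ex; have /andP[r0 r1] := r01.
have m1 : 1 <= m by rewrite ler1n.
have m0 : 0 < m by rewrite ltr0n.
have M0 : 0 < 2 * m by rewrite mulr_gt0.
pose u k := iter k (fun y => y - (2 * m)^-1%:C *: laplacian y) x.
have Eu k : energy (u k) <= 2 * m * (a * rho ^+ k) ^+ 2.
  elim: k => [|k IH]; first by rewrite expr0 mulr1.
  apply: le_trans (energy_gradient_step _ S_gt0) _; rewrite -/(u k).
  apply: (@le_trans _ _ (rho ^+ 2 * energy (u k))).
    rewrite -[leRHS](subKr (energy (u k))) lerD2l lerN2 ler_pdivlMr //.
    apply: le_trans (gap (u k)).
    by rewrite le_eqVlt; apply/orP; left; apply/eqP; ring.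
  apply: (le_trans (ler_wpM2l (sqr_ge0 _) IH)).
  by rewrite le_eqVlt; apply/orP; left; apply/eqP; rewrite (exprS rho k); ring.
have ark k : 0 <= a * rho ^+ k by rewrite mulr_ge0 ?exprn_ge0.
have du k : rnorm (u k.+1 - u k) <= a * rho ^+ k.
  apply: rnorm_le => //; rewrite /= addrAC subrr add0r.
  rewrite rdotNl rdotNr opprK rdotZl rdotZr -/(u k).
  rewrite !ler_pdivrMl //; apply: le_trans (laplacian_le_energy _) _.
  by rewrite ler_pM2l.
have [l ul] := geometric_cvg r01 a0 du.
have l0 : l = 0.
  apply: noinv => g; move: g; apply: (generating_set_ind S_gen).
  - exact: rep_one.
  - move=> s sS; apply/eqP; rewrite -subr_eq0; apply/eqP/rnorm_eq0/eqP.
    rewrite eq_le rnorm_ge0 andbT leNgt; apply/negP => hl.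
    (* The displacement of [l] by [s] is at most twice the distance from [l] to [u k] plus the
       displacement of [u k]. The square of the latter is at most twice the energy; [1 <= m] allows
       the constant [2 * m] in place of twice the square root of [m]. *)
    have [k hk] := expr_lt_ex (2 * (a / (1 - rho)) + 2 * m * a) r01 hl.
    have h1 : rnorm (pi s (l - u k)) <= a / (1 - rho) * rho ^+ k.
      apply: le_trans (ul k); rewrite -(rnormN (u k - l)) opprB.
      by apply: rnorm_le; rewrite ?rnorm_ge0 // rdot_rep rdotxx.
    have h2 : rnorm (u k - pi s (u k)) <= 2 * m * (a * rho ^+ k).
      apply: rnorm_le; first by rewrite mulr_ge0 // ltW.
      apply: (@le_trans _ _ (2 * energy (u k))).
        rewrite dirichlet_energy mulrC divfK // (big_rem s) //= lerDl.
        by rewrite sumr_ge0 // => t _; exact: rdot_ge0.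
      apply: (le_trans (ler_wpM2l _ (Eu k))) => //.
      rewrite [leRHS]exprMn mulrA ler_wpM2r ?sqr_ge0 // expr2.
      by rewrite ler_pM2r // ler_peMr.
    have := rnorm_triangle (pi s (l - u k)) (- (u k - pi s (u k)) + (u k - l)).
    have -> : pi s (l - u k) + (- (u k - pi s (u k)) + (u k - l)) = pi s l - l.
      by rewrite linearB /= opprB !subrKA.
    have := rnorm_triangle (- (u k - pi s (u k))) (u k - l).
    rewrite rnormN; have := ul k; lra.
  - move=> g h gl hl; rewrite rep_mul -{1}hl -rep_mul -rep_mul -mulgA mulVg mulg1.
    exact: gl.
have := ul 0%N; rewrite l0 subr0 expr0 mulr1; exact.
Qed.

End Laplacian.

(** * Kernels of orbit maps *)

Section OrbitKernel.
Variables (R : realType) (G : groupType) (S : {fset G}).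

Definition orbit_kernel (H : hilbertType R) (pi : G -> {linear H -> H}) (x : H)
    (g h : G) : R :=
  rdot (pi g x - x) (pi h x - x) / energy S pi x.

Definition near_harmonic_kernel (eps : R) (K : G -> G -> R) : Prop :=
  exists (H : hilbertType R) (pi : G -> {linear H -> H}) (x : H),
    [/\ unitary_rep pi, 0 < energy S pi x,
        rdot (laplacian S pi x) (laplacian S pi x) <= eps * energy S pi x
      & K = orbit_kernel pi x].

Section Fixed.
Variables (H : hilbertType R) (pi : G -> {linear H -> H}) (x : H).
Hypotheses (pi_unitary : unitary_rep pi) (E0 : 0 < energy S pi x).
Local Notation K := (orbit_kernel pi x).
Let b g := pi g x - x.

Let bM g h : b (g * h)%g = pi g (b h) + b g.
Proof. by rewrite /b rep_mul // linearB subrKA. Qed.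

Lemma orbit_kernelC g h : K g h = K h g.
Proof. by rewrite /orbit_kernel rdotC. Qed.

(** The real part of [a * conjc b] splits into products of real parts and of imaginary parts, so the
    Gramian is a sum of two squared norms over the energy. *)
Lemma orbit_kernel_psd t : 0 <= gramian K t t.
Proof.
pose cR (z : R[i]) := (complex.Re z)%:C : R[i].
pose cI (z : R[i]) := (complex.Im z)%:C : R[i].
have -> : gramian K t t =
    (rdot (\sum_(a <- t) cR a.1 *: b a.2) (\sum_(a <- t) cR a.1 *: b a.2) +
     rdot (\sum_(a <- t) cI a.1 *: b a.2) (\sum_(a <- t) cI a.1 *: b a.2)) /
    energy S pi x.
  rewrite !rdot_suml -big_split mulr_suml; apply: eq_bigr => a _ /=.
  rewrite !rdot_sumr -big_split mulr_suml; apply: eq_bigr => c _ /=.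
  rewrite !rdotZl !rdotZr /orbit_kernel -/(b _) -/(b _).
  by case: (a.1) (c.1) => [u v] [u' v'] /=; ring.
by rewrite divr_ge0 ?addr_ge0 ?rdot_ge0 // ltW.
Qed.

Lemma orbit_kernel1 h : K 1%g h = 0.
Proof. by rewrite /orbit_kernel (rep_one pi_unitary) subrr rdot0l mul0r. Qed.

(** Both sides equal the inner product of [b y] and [pi g (b h)] over the energy. This is the
    cocycle relation written without the representation. *)
Lemma orbit_kernel_cocycle g y h :
  K (g^-1 * y)%g h - K (g^-1)%g h = K y (g * h)%g - K y g.
Proof.
rewrite /orbit_kernel -!mulrBl -!/(b _); congr (_ / _).
rewrite (bM g h) bM (rdotDl _ (b g^-1%g)) addrK (rdotDr _ (b g)) addrK.
by rewrite (rdot_repl pi_unitary) invgK.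
Qed.

Lemma orbit_kernel_trace : \sum_(s <- S) K s s = 2.
Proof.
rewrite -mulr_suml; apply: (canLR (mulfK _)); first by rewrite gt_eqF.
rewrite dirichlet_energy // mulrC divfK //; apply: eq_bigr => s _.
by rewrite -[x - _]opprB rdotNl rdotNr opprK.
Qed.

(** The cocycle relation turns the defect into the inner product of [b y] with the image under
    [pi g] of the Laplacian of [x], over the energy; Cauchy-Schwarz concludes. *)
Lemma orbit_kernel_harmonic eps y g :
  rdot (laplacian S pi x) (laplacian S pi x) <= eps * energy S pi x ->
  (\sum_(s <- S) (K y g - K y (g * s)%g)) ^+ 2 <= eps * K y y.
Proof.
move=> Dx.
have -> : \sum_(s <- S) (K y g - K y (g * s)%g) =
    rdot (b y) (pi g (laplacian S pi x)) / energy S pi x.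
  rewrite /laplacian linear_sum rdot_sumr mulr_suml; apply: eq_bigr => s _.
  rewrite /orbit_kernel -mulrBl -!/(b _) bM (rdotDr _ (b g)) opprD addrCA subrr addr0.
  by rewrite -rdotNr -linearN opprB.
rewrite expr_div_n ler_pdivrMr ?exprn_gt0 //.
apply: le_trans (rdot_CS _ _) _; rewrite (rdot_rep pi_unitary).
have -> : eps * K y y * energy S pi x ^+ 2 =
    rdot (b y) (b y) * (eps * energy S pi x).
  rewrite /orbit_kernel -/(b y); field; rewrite gt_eqF //.
by rewrite ler_wpM2l ?rdot_ge0.
Qed.

Lemma orbit_kernel_amgm g h : `|K g h| <= (K g g + K h h) / 2.
Proof.
have iE : 0 < (energy S pi x)^-1 by rewrite invr_gt0.
rewrite /orbit_kernel normrM (gtr0_norm iE) -mulrDl mulrAC ler_pM2r //; exact: rdot_amgm.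
Qed.

Lemma orbit_kernelMV g h : K (g * h^-1)%g (g * h^-1)%g <= 2 * K h h + 2 * K g g.
Proof.
rewrite /orbit_kernel -!/(b _) !mulrA -mulrDl ler_pM2r ?invr_gt0 // bM.
have <- : rdot (pi g (b h^-1%g)) (pi g (b h^-1%g)) = rdot (b h) (b h).
  rewrite rdot_rep // -(rdot_rep pi_unitary h) /b linearB -rep_mul // mulgV.
  by rewrite (rep_one pi_unitary) -opprB rdotNl rdotNr opprK.
move: (pi g _) (b g) => u v; have := rdot_ge0 (u - v).
by rewrite !(rdotDl, rdotDr, rdotNl, rdotNr) (rdotC v u); lra.
Qed.

End Fixed.

Hypotheses (S_sym : symmetric_set S) (S_gen : generating_set S).

(** The trace bounds the diagonal by 2 on generators, and [orbit_kernelMV] propagates bounds to all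
    words. The constant depends on [g] alone, which allows limits over varying representations. *)
Lemma orbit_kernel_bound g : exists C : R, forall (H : hilbertType R)
    (pi : G -> {linear H -> H}) (x : H), unitary_rep pi -> 0 < energy S pi x ->
  orbit_kernel pi x g g <= C.
Proof.
move: g; apply: (generating_set_ind S_gen).
- by exists 0 => H pi x piU E0; rewrite orbit_kernel1.
- move=> s sS; exists 2 => H pi x piU E0.
  rewrite -(orbit_kernel_trace piU E0) (big_rem s) //= lerDl sumr_ge0 // => t _.
  by rewrite divr_ge0 ?rdot_ge0 // ltW.
- move=> u v [C hC] [D hD]; exists (2 * D + 2 * C) => H pi x piU E0.
  apply: le_trans (orbit_kernelMV piU E0 _ _) _.
  by have := hC H pi x piU E0; have := hD H pi x piU E0; lra.
Qed.

Hypothesis notT : ~ property_T R G.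

Lemma not_property_T (e : R) : 0 < e ->
  exists (H : hilbertType R) (pi : G -> {linear H -> H}) (x : H),
    [/\ unitary_rep pi, almost_invariant_vector pi S e x
      & forall y, invariant_vector pi y -> y = 0].
Proof.
move=> e0; apply: contrapT => noH; apply: notT; exists S, e; split=> //.
move=> H pi piU [x xe]; apply: contrapT => noinv; apply: noH.
exists H, pi, x; split=> // y yinv; apply: contrapT => y0; apply: noinv.
by exists y; split=> //; apply/eqP.
Qed.

Lemma generating_set_gt0 : (0 < size S)%N.
Proof.
rewrite lt0n; apply/eqP => S0.
have [H [pi [x [piU [x0 _] noinv]]]] := not_property_T ltr01.
(* An empty generating set makes every vector invariant, hence zero, against [x != 0]. *)
move/eqP: x0; apply; apply: noinv => g; move: g.
apply: (generating_set_ind S_gen).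
- exact: rep_one.
- by move=> s; move/cardfs0_eq: S0 => ->; rewrite inE.
- move=> u v ux vx; rewrite (rep_mul piU) -{1}vx -(rep_mul piU v^-1%g) mulVg.
  by rewrite (rep_one piU).
Qed.

Lemma near_harmonic_kernel_exists (eps : R) : 0 < eps ->
  exists K, near_harmonic_kernel eps K.
Proof.
move=> eps0; have S0 := generating_set_gt0.
have m0 : 0 < (size S)%:R :> R by rewrite ltr0n.
set m : R := (size S)%:R in m0.
(* [spectral_gap] is used with [rho = 1 - eta]: [eta <= 1] keeps [rho] nonnegative, and
   [4 * m * eta <= eps] makes [eps] at least the required gap [2 * m * (1 - rho ^+ 2)]. *)
pose eta := Num.min 1 (eps / (4 * m)).
have eta0 : 0 < eta by rewrite /eta lt_min ltr01 divr_gt0 // mulr_gt0.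
have eta1 : eta <= 1 by rewrite /eta ge_min lexx.
have etae : 4 * m * eta <= eps.
  by rewrite mulrC -ler_pdivlMr ?mulr_gt0 // /eta ge_min lexx orbT.
have [H [pi [x [piU [x0 xe] noinv]]]] := not_property_T eta0.
apply: contrapT => noK.
have gap y : eps * energy S pi y <= rdot (laplacian S pi y) (laplacian S pi y).
  rewrite leNgt; apply/negP => hy; apply: noK.
  exists (orbit_kernel pi y), H, pi, y; split=> //; last exact: ltW.
  by rewrite -(pmulr_rgt0 _ eps0); apply: le_lt_trans hy; exact: rdot_ge0.
have xp : 0 < rnorm x.
  rewrite lt_def rnorm_ge0 andbT; apply: contra_neq x0; exact: rnorm_eq0.
(* Almost invariance bounds the energy with [a = eta * rnorm x / 2], and [a / (1 - rho)] is only
   half of the positive norm of [x]. *)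
suff : rnorm x <= eta * rnorm x / 2 / (1 - (1 - eta)).
  have -> : eta * rnorm x / 2 / (1 - (1 - eta)) = rnorm x / 2.
    by rewrite subKr; field; rewrite gt_eqF.
  lra.
apply: (spectral_gap S_sym piU S_gen S0).
- by apply/andP; split; lra.
- by rewrite divr_ge0 // mulr_ge0 // ltW.
- move=> y; apply: le_trans (gap y); apply: ler_wpM2r; first exact: energy_ge0.
  rewrite -/m; apply: le_trans etae.
  have -> : 1 - (1 - eta) ^+ 2 = 2 * eta - eta ^+ 2 by ring.
  have := mulr_ge0 (ltW m0) (sqr_ge0 eta); lra.
- exact: noinv.
- rewrite dirichlet_energy // -/m ler_pdivrMr //.
  have -> : 2 * m * (eta * rnorm x / 2) ^+ 2 * 2 =
      \sum_(s <- S) (eta * rnorm x) ^+ 2.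
    by rewrite big_const_seq count_predT iter_addr_0 -mulr_natl -/m; field.
  rewrite !big_seq; apply: ler_sum => s sS; rewrite rdotxx.
  rewrite ler_pXn2r ?nnegrE ?rnorm_ge0 ?mulr_ge0 ?(ltW eta0) ?(ltW xp) //.
  rewrite -rnormN opprB; have := xe s sS.
  by rewrite !rnormE -rmorphM ltcR => /ltW.
Qed.

End OrbitKernel.

(** * The limit kernel and its affine action *)

(** Compactness of the segment gives a cluster point, and a cluster point of an ultrafilter is a
    limit. *)
Lemma ultra_bounded_cvg (R : realType) (T : Type) (U : set_system T)
    (u : T -> R) (C : R) : UltraFilter U -> (forall n, `|u n| <= C) ->
  cvg (u @ U).
Proof.
move=> UU uC.
have [|p [_ clp]] := @segment_compact R (- C) C (u @ U) _.
  suff : U (u @^-1` `[- C, C]) by [].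
  by apply: filterE => n; rewrite /preimage /= in_itv /= -ler_norml; exact: uC.
apply/cvg_ex; exists p => B pB.
have [//|UB] := in_ultra_setVsetC (u @^-1` B) UU.
by have [x [nBx Bx]] := clp (~` B) B UB pB.
Qed.

Section CocycleKernel.
Variables (R : realType) (G : groupType) (K : psdKernel R G).
Hypothesis K1 : forall h, K 1%g h = 0.
Hypothesis K_cocycle : forall g x h,
  K (g^-1 * x)%g h - K (g^-1)%g h = K x (g * h)%g - K x g.
Local Notation H := (rkhs K).
Implicit Types (f : H) (g h x : G).

(** Positivity of the Gramian at [t] minus the point mass at [h] is exactly the bound of the test
    value at [t] by [K h h]. *)
Lemma rkhs_section_finite h : (fun x => (K x h)%:C) \in rkhs_finite K.
Proof.
apply: (@qnorm_le _ _ K _ (K h h) _).1 => t.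
have := kernel_psd K (t ++ [:: (-1, h)]).
rewrite gramian_catl !gramian_catr (gramianC K [:: _] t).
have -> : gramian K t [:: (-1, h)] = - evs t (fun x => (K x h)%:C).
  rewrite evsE -sumrN; apply: eq_bigr => a _; rewrite big_seq1 /=.
  by case: (a.1) => u v /=; ring.
have -> : gramian K [:: (-1, h)] [:: (-1, h)] = K h h.
  by rewrite /gramian !big_seq1 /=; ring.
lra.
Qed.

Definition rkhs_section h : H := Rkhs (rkhs_section_finite h).

(** The dual of [translate_fun] on formal sums. It preserves the Gramian by the cocycle relation, so
    [translate] does not increase norms. *)
Let dilate g (t : seq (R[i] * G)) :=
  [seq (a.1, (g^-1 * a.2)%g) | a <- t] ++ [seq (- a.1, (g^-1)%g) | a <- t].

(* The linear part of the affine action, determined by                         *)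
(* [K(-, h) |-> K(-, gh) - K(-, g)].                                           *)
Definition translate_fun g (f : G -> R[i]) : G -> R[i] :=
  fun x => f (g^-1 * x)%g - f (g^-1)%g.

Let evs_dilate g t (f : G -> R[i]) : evs (dilate g t) f = evs t (translate_fun g f).
Proof.
rewrite evs_cat !evsE !big_map -big_split; apply: eq_bigr => a _ /=.
by rewrite mulNr -raddfD -mulrBr.
Qed.

Let gramian_dilate g t : gramian K (dilate g t) (dilate g t) = gramian K t t.
Proof.
rewrite gramian_catl !gramian_catr /gramian !big_map -!big_split.
apply: eq_bigr => a _ /=; rewrite !big_map -!big_split.
apply: eq_bigr => b _ /=.
have h1 := K_cocycle g a.2 (g^-1 * b.2)%g.
have h2 := K_cocycle g a.2 (g^-1)%g.
rewrite mulgA mulgV mul1g in h1; rewrite mulgV (kernel_sym K a.2 1%g) K1 in h2.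
have e : K (g^-1 * a.2)%g (g^-1 * b.2)%g =
  K (g^-1)%g (g^-1 * b.2)%g + K (g^-1 * a.2)%g (g^-1)%g - K (g^-1)%g (g^-1)%g
  + K a.2 b.2 by lra.
rewrite e; case: (a.1) (b.1) => [u v] [u' v'] /=; ring.
Qed.

Let translate_qnorm g f :
  translate_fun g (rkhs_fun f) \in rkhs_finite K /\
  qnorm K (translate_fun g (rkhs_fun f)) <= sqnorm f.
Proof.
apply: qnorm_le => t; rewrite -evs_dilate -(gramian_dilate g).
exact/qnorm_ub/rkhs_funP.
Qed.

Definition translate g f : H := Rkhs (translate_qnorm g f).1.

Lemma rkhs_fun1 f : rkhs_fun f 1%g = 0.
Proof.
have := eval_qnorm 1%g (rkhs_funP f); rewrite K1 mul0r.
set a := complex.Re _; set b := complex.Im _ => ab.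
have a2 := sqr_ge0 a; have b2 := sqr_ge0 b.
apply/eqP; rewrite eq_complex -/a -/b /= -(sqrf_eq0 a) -(sqrf_eq0 b).
by apply/andP; split; apply/eqP; lra.
Qed.

Lemma translate1 f : translate 1 f = f.
Proof.
apply/val_inj/funext => x /=.
by rewrite /translate_fun invg1 mul1g rkhs_fun1 subr0.
Qed.

Lemma translateM g h f : translate (g * h) f = translate g (translate h f).
Proof.
apply/val_inj/funext => x /=; rewrite /translate_fun invgM -mulgA.
by rewrite opprB subrKA.
Qed.

Lemma translate_linear g : linear (translate g).
Proof.
move=> a f1 f2; apply/val_inj/funext => x /=.
rewrite -[RHS]/(a * translate_fun g (rkhs_fun f1) x +
                translate_fun g (rkhs_fun f2) x) /translate_fun.
by rewrite mulrBr [RHS]addrACA -opprD.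
Qed.

HB.instance Definition _ g := GRing.isLinear.Build R[i] H H *:%R (translate g)
  (translate_linear g).

(** A contraction whose inverse, the translation by [g^-1], is also a contraction is isometric. *)
Lemma sqnorm_translate g f : sqnorm (translate g f) = sqnorm f.
Proof.
apply/eqP; rewrite eq_le (translate_qnorm g f).2 /=.
rewrite -{1}(translate1 f) -(mulVg g) translateM.
exact: (translate_qnorm _ _).2.
Qed.

Definition affine_action g f : H := translate g f + rkhs_section g.

Lemma affine_action_section g h :
  affine_action g (rkhs_section h) = rkhs_section (g * h)%g.
Proof.
apply/val_inj/funext => x.
rewrite -[LHS]/((K (g^-1 * x)%g h)%:C - (K (g^-1)%g h)%:C + (K x g)%:C).
by rewrite -[RHS]/((K x (g * h)%g)%:C) -rmorphB -rmorphD K_cocycle subrK.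
Qed.

Lemma norm_affine_action g (f1 f2 : H) :
  `|affine_action g f1 - affine_action g f2| = `|f1 - f2|.
Proof.
rewrite /affine_action opprD addrACA subrr addr0 -linearB.
by rewrite !rkhs_normE sqnorm_translate.
Qed.

Lemma equivariant_rkhs_section :
  equivariant (rkhs_section : G -> rkhsHilbert K).
Proof.
exists affine_action; split; last exact: affine_action_section.
split=> [g|f|g h f].
- split; first by exists (translate g), (rkhs_section g).
  exact: norm_affine_action.
- rewrite /affine_action translate1.
  have -> : rkhs_section 1 = 0.
    by apply/val_inj/funext => x; rewrite /= kernel_sym K1.
  by rewrite addr0.
- rewrite /affine_action linearD -addrA -/(affine_action g _).
  by rewrite affine_action_section translateM.
Qed.

Lemma srw_harmonic_rkhs_section (S : {fset G}) : (0 < size S)%N ->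
  (forall x g, \sum_(s <- S) (K x g - K x (g * s)%g) = 0) ->
  srw_harmonic S (rkhs_section : G -> rkhsHilbert K).
Proof.
move=> S0 KS g; apply/val_inj/funext => x.
have e (s : seq G) : rkhs_fun (\sum_(i <- s) rkhs_section (g * i)%g) x =
    (\sum_(i <- s) K x (g * i)%g)%:C.
  elim: s => [|i s IH]; first by rewrite !big_nil.
  by rewrite !big_cons rmorphD /= -[(\sum_(j <- s) _)%:C]IH.
rewrite -[RHS]/((size S)%:R^-1 *
  rkhs_fun (\sum_(i <- S) rkhs_section (g * i)%g) x) e.
have := KS x g; rewrite big_split sumrN /= big_const_seq count_predT iter_addr_0.
move=> /subr0_eq <-; rewrite rmorphMn -(mulr_natl (K x g)%:C) mulKf //.
by rewrite pnatr_eq0 -lt0n.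
Qed.

End CocycleKernel.

(** * Passage to the limit and conclusion *)

Section LimitKernel.
Variables (R : realType) (G : groupType) (S : {fset G}).
Hypotheses (S_sym : symmetric_set S) (S_gen : generating_set S).
Hypothesis notT : ~ property_T R G.

Lemma harmonic_kernel_exists : exists K : psdKernel R G,
  [/\ forall h, K 1%g h = 0,
      forall g x h, K (g^-1 * x)%g h - K (g^-1)%g h = K x (g * h)%g - K x g,
      \sum_(s <- S) K s s = 2
    & forall x g, \sum_(s <- S) (K x g - K x (g * s)%g) = 0].
Proof.
have eps0 n : 0 < n.+1%:R^-1 :> R by rewrite invr_gt0.
have [Kn KnP] := choice (fun n => near_harmonic_kernel_exists S_sym S_gen notT (eps0 n)).
(* The ultrafilter makes all bounded sequences [Kn n x y] converge at once; it refines [\oo], so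
   [n.+1%:R^-1] still tends to 0 along it. *)
have [U [UU sU]] := @ultraFilterLemma _ (\oo : set_system nat) _.
have [C hC] := choice (orbit_kernel_bound R S_gen).
have Kcvg x y : cvg (Kn n x y @[n --> U]).
  apply: (ultra_bounded_cvg (C := (C x + C y) / 2)) => n.
  have [H [pi [v [piU E0 _ ->]]]] := KnP n.
  apply: le_trans (orbit_kernel_amgm E0 x y) _.
  by have := hC x H pi v piU E0; have := hC y H pi v piU E0; lra.
pose K x y : R := lim (Kn n x y @[n --> U]).
have KnK x y : Kn n x y @[n --> U] --> K x y by exact: Kcvg.
have lim_eq (u v : nat -> R) (a b : R) : u @ U --> a -> v @ U --> b ->
    (forall n, u n = v n) -> a = b.
  by move=> + vb /funext uv; rewrite uv => ub; exact: cvg_unique vb.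
have Ksym x y : K x y = K y x.
  apply: (lim_eq _ _ _ _ (KnK x y) (KnK y x)) => n.
  by have [H [pi [v [_ _ _ ->]]]] := KnP n; exact: orbit_kernelC.
have Kpsd t : 0 <= gramian K t t.
  have gU : gramian (Kn n) t t @[n --> U] --> gramian K t t.
    apply: cvg_sum_seq => a; apply: cvg_sum_seq => b.
    by apply: cvgM => //; exact: cvg_cst.
  apply: (cvgr_to_ge gU); apply: filterE => n.
  by have [H [pi [v [_ E0 _ ->]]]] := KnP n; exact: orbit_kernel_psd.
exists (PsdKernel Ksym Kpsd); split=> /=.
- move=> h; apply: (lim_eq _ _ _ _ (KnK 1%g h) (cvg_cst 0)) => n.
  by have [H [pi [v [piU _ _ ->]]]] := KnP n; exact: orbit_kernel1.
- move=> g x h.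
  apply: (lim_eq _ _ _ _ (cvgB (KnK _ _) (KnK _ _)) (cvgB (KnK _ _) (KnK _ _))).
  move=> n; have [H [pi [v [piU _ _ KnE]]]] := KnP n.
  have := @orbit_kernel_cocycle _ _ S _ _ v piU g x h; rewrite -KnE; exact.
- have trU : (\sum_(s <- S) Kn n s s) @[n --> U] --> \sum_(s <- S) K s s.
    by apply: cvg_sum_seq => s; exact: KnK.
  apply: (lim_eq _ _ _ _ trU (cvg_cst (2 : R))) => n.
  by have [H [pi [v [piU E0 _ ->]]]] := KnP n; exact: orbit_kernel_trace.
- move=> x g.
  set d := \sum_(s <- S) _.
  have dU : (\sum_(s <- S) (Kn n x g - Kn n x (g * s)%g)) @[n --> U] --> d.
    by apply: cvg_sum_seq => s; apply: cvgB; exact: KnK.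
  have n0 : C x * n.+1%:R^-1 @[n --> U] --> C x * 0.
    apply: cvgMl_tmp; apply: (cvg_trans _ (@cvg_harmonic R)).
    by move=> A; exact: sU.
  (* The squared defect of the n-th kernel is at most [C x * n.+1%:R^-1], so it vanishes in the
     limit. *)
  have : d ^+ 2 <= C x * 0.
    apply: (ler_cvg_to (cvgM dU dU) n0); apply: filterE => n /=.
    have [H [pi [v [piU E0 Dv KnE]]]] := KnP n.
    rewrite KnE -expr2.
    apply: le_trans (orbit_kernel_harmonic piU E0 _ _ Dv) _.
    by rewrite mulrC ler_wpM2r ?(ltW (eps0 n)) // hC.
  by rewrite mulr0 => d2; apply/eqP; rewrite -sqrf_eq0 eq_le d2 sqr_ge0.
Qed.

End LimitKernel.

Theorem theorem3p8 (R : realType) (G : groupType) (S : {fset G})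
    (S_sym : symmetric_set S) (S_gen : generating_set S)
    (notT : ~ property_T R G) :
  exists (H : hilbertType R) (Psi : G -> H),
    [/\ equivariant Psi, srw_harmonic S Psi & exists g h : G, Psi g <> Psi h].
Proof.
have [K [K1 Kc Ktr Kh]] := harmonic_kernel_exists S_sym S_gen notT.
exists (rkhsHilbert K), (@rkhs_section R G K); split.
- exact: equivariant_rkhs_section.
- by apply: srw_harmonic_rkhs_section => //; exact: generating_set_gt0 notT.
(* If the section at [s] equals the section at 1, which is zero, then [K s s = 0]; for all [s] in
   [S] this contradicts the trace 2. *)
- apply: contrapT => Psi_cst; suff : (0 : R) = 2 by lra.
  rewrite -Ktr big1 // => s _.
  have : rkhs_section K s = rkhs_section K 1%g.
    by apply: contrapT => ne; apply: Psi_cst; exists s, 1%g.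
  move=> /(congr1 (fun f => rkhs_fun f s)) /complexI ->.
  by rewrite kernel_sym K1.
Qed.
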